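(* Let $\mathcal{O}_K$ be a Dedekind domain with field of fractions $K$, $\operatorname{char}K\neq 2$, and let $\mathcal{O}$ be an order of rank $n$ in an étale $K$-algebra $L$. If $(\mathfrak{c},D)$ is the discriminant of $\mathcal{O}$, then $D\equiv t^2\pmod{4\mathfrak{c}^{-2}}$ for some $t\in\mathfrak{c}^{-1}$.
   Context: An order is a subring of $L$ containing $1$ that is a finitely generated torsion-free $\mathcal{O}_K$-module of full rank. The discriminant of $\mathcal{O}$ is defined as follows: the map $(\xi_1,\dots,\xi_n,\eta_1,\dots,\eta_n)\mapsto\det[\operatorname{tr}_{L/K}(\xi_i\eta_j)]_{i,j}$ is alternating in the $\xi$'s and in the $\eta$'s, hence defines a bilinear form on the rank-one lattice $\Lambda^n\mathcal{O}$. Identifying $\Lambda^n\mathcal{O}$ with a fractional ideal $\mathfrak{c}$ of $K$, this form becomes $(\xi,\eta)\mapsto D\xi\eta$ for a nonzero $D\in\mathfrak{c}^{-2}$; rescaling the identification by $\lambda\in K^\times$ replaces $(\mathfrak{c},D)$ by $(\lambda\mathfrak{c},\lambda^{-2}D)$. Any such pair $(\mathfrak{c},D)$ is called a discriminant of $\mathcal{O}$ (the statement holds for each such pair). *)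

(* Defs.v *)
From HB Require Import structures.
From mathcomp Require Import all_boot all_order all_fingroup all_algebra all_field.
From mathcomp Require Import boolp classical_sets.

Set Implicit Arguments.
Unset Strict Implicit.
Unset Printing Implicit Defensive.

Import GRing.Theory.
Local Open Scope ring_scope.
Local Open Scope classical_set_scope.

Notation "x %:F" := (@FracField.tofrac _ x) (format "x %:F") : ring_scope.

Section Submodules.
Variables (A : comNzRingType) (M : lmodType A).
Implicit Types (S : set M).

Definition submodule S : Prop :=
  [/\ S 0,
      forall x y, S x -> S y -> S (x + y) &
      forall (a : A) x, S x -> S (a *: x)].

Definition span_of (m : nat) (g : 'I_m -> M) : set M :=
  [set x | exists a : 'I_m -> A, x = \sum_i a i *: g i].

Definition finitely_generated S : Prop :=
  exists (m : nat) (g : 'I_m -> M), S = span_of g.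

End Submodules.

(* Ideals of A are the submodules of the regular module A^o. *)
Section DedekindDomains.
Variable A : idomainType.
Implicit Types (I J : set A).

Definition ideal I : Prop := submodule (I : set A^o).

Definition noetherian : Prop :=
  forall I, ideal I -> finitely_generated (I : set A^o).

Definition prime_ideal I : Prop :=
  [/\ ideal I, ~ I 1 & forall a b, I (a * b) -> I a \/ I b].

Definition maximal_ideal I : Prop :=
  [/\ ideal I, ~ I 1 & forall J, ideal J -> I `<=` J -> J = I \/ J = setT].

Definition integrally_closed : Prop :=
  forall x : {fraction A},
    integralOver (@FracField.tofrac A) x -> exists a : A, x = a%:F.

(* Fields are allowed: only nonzero primes are required to be maximal. *)
Definition dedekind_domain : Prop :=
  [/\ noetherian, integrally_closed &
      forall I, prime_ideal I -> I <> [set 0] -> maximal_ideal I].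

End DedekindDomains.

(* A {fraction A}-vector space seen as an A-module. *)
Definition restr (A : idomainType) (V : lmodType {fraction A}) : Type := V.

Section RestrictionOfScalars.
Variables (A : idomainType) (V : lmodType {fraction A}).

HB.instance Definition _ := GRing.Zmodule.on (restr V).

Definition restr_scale (a : A) (x : restr V) : restr V := a%:F *: (x : V).

Fact restr_scaleA a b x :
  restr_scale a (restr_scale b x) = restr_scale (a * b) x.
Proof. by rewrite /restr_scale scalerA rmorphM. Qed.

Fact restr_scale1 : left_id 1 restr_scale.
Proof. by move=> x; rewrite /restr_scale rmorph1 scale1r. Qed.

Fact restr_scaleDr : right_distributive restr_scale +%R.
Proof. by move=> a x y; rewrite /restr_scale scalerDr. Qed.

Fact restr_scaleDl x : {morph restr_scale^~ x : a b / a + b}.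
Proof. by move=> a b; rewrite /restr_scale rmorphD scalerDl. Qed.

HB.instance Definition _ := GRing.Zmodule_isLmodule.Build A (restr V)
  restr_scaleA restr_scale1 restr_scaleDr restr_scaleDl.

End RestrictionOfScalars.

Section FractionalIdeals.
Variable A : idomainType.
Local Notation K := {fraction A}.
Implicit Types (c I J : set K).

Definition fractional_ideal c : Prop :=
  [/\ submodule (c : set (restr K^o)),
      exists2 x, c x & x != 0 &
      exists2 d : A, d != 0 & forall x, c x -> exists a : A, d%:F * x = a%:F].

Definition fideal_inv c : set K :=
  [set x | forall y, c y -> exists a : A, x * y = a%:F].

Definition fideal_mul I J : set K :=
  [set x | exists (m : nat) (u v : 'I_m -> K),
    [/\ forall i, I (u i), forall i, J (v i) & x = \sum_i u i * v i]].

Definition fideal_inv2 c : set K := fideal_mul (fideal_inv c) (fideal_inv c).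

(* x = y mod r J *)
Definition congr_mod (x y r : K) J : Prop :=
  exists2 z, J z & x - y = r * z.

End FractionalIdeals.

(* Finite products of finite separable field extensions; F i ranges over
   finite extensions because fieldExtType bundles finite dimension. *)
Definition etale (K : fieldType) (L : falgType K) : Prop :=
  exists (r : nat) (F : 'I_r -> fieldExtType K) (f : forall i, 'AHom(L, F i)),
    (forall i, separable 1%VS {: F i}%VS) /\
    (forall y : (forall i, F i), exists! x : L, forall i, f i x = y i).

Definition alg_trace (K : fieldType) (L : falgType K) (x : L) : K :=
  \tr (passmx.mxof (vbasis {: L}) (vbasis {: L}) (amull x)).

Section ExteriorPowers.
Variables (A : comNzRingType) (M : lmodType A) (n : nat).
Implicit Types (S : set M) (N : lmodType A).

Definition family_in S (xi : 'I_n -> M) : Prop := forall i, S (xi i).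

Definition upd (xi : 'I_n -> M) (i : 'I_n) (x : M) : 'I_n -> M :=
  fun j => if j == i then x else xi j.

Definition alternating_on S N (f : ('I_n -> M) -> N) : Prop :=
  (forall xi i (a : A) x y, family_in S xi -> S x -> S y ->
     f (upd xi i (a *: x + y)) = a *: f (upd xi i x) + f (upd xi i y)) /\
  (forall xi i j, family_in S xi -> i != j -> xi i = xi j -> f xi = 0).

Definition linear_on N N' (T : set N) (g : N -> N') : Prop :=
  forall (a : A) x y, T x -> T y -> g (a *: x + y) = a *: g x + g y.

(* The submodule T, with (xi_1, ..., xi_n) |-> w xi in the role of
   xi_1 /\ ... /\ xi_n, satisfies the universal property of the n-th exterior
   power of the submodule S: that is, w amounts to an isomorphism from
   Lambda^n S to T. Values of w outside S are irrelevant. *)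
Definition exterior_power S N (T : set N) (w : ('I_n -> M) -> N) : Prop :=
  [/\ forall xi, family_in S xi -> T (w xi),
      alternating_on S w &
      forall N' (f : ('I_n -> M) -> N'), alternating_on S f ->
        exists g : N -> N',
          [/\ linear_on T g,
              forall xi, family_in S xi -> f xi = g (w xi) &
              forall g' : N -> N', linear_on T g' ->
                (forall xi, family_in S xi -> f xi = g' (w xi)) ->
                forall y, T y -> g' y = g y]].

End ExteriorPowers.

Section Orders.
Variables (A : idomainType) (L : falgType {fraction A}) (n : nat).
Local Notation K := {fraction A}.

(* O is torsion-free because it lies in a K-vector space; it has full rank n
   when it contains a K-basis of L, with n elements. *)
Definition is_order (O : set L) : Prop :=
  [/\ O 1,
      forall x y, O x -> O y -> O (x - y),
      forall x y, O x -> O y -> O (x * y),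
      submodule (O : set (restr L)) /\
        finitely_generated (O : set (restr L)) &
      exists2 b : n.-tuple L, basis_of {: L}%VS b & forall i, O (tnth b i)].

Definition disc_form (xi eta : 'I_n -> L) : K :=
  \det (\matrix_(i < n, j < n) alg_trace (xi i * eta j)).

Definition is_discriminant (O : set L) (c : set K) (D : K) : Prop :=
  fractional_ideal c /\
  exists2 w : ('I_n -> L) -> K,
    exterior_power (M := restr L) (N := restr K^o) O c w &
    forall xi eta, (forall i, O (xi i)) -> (forall i, O (eta i)) ->
      disc_form xi eta = D * w xi * w eta.

End Orders.

(* Main.v *)
From HB Require Import structures.
Require Import Defs.
From mathcomp Require Import all_boot all_order all_fingroup all_algebra all_field.
From mathcomp Require Import boolp classical_sets.
From mathcomp Require Import ring.

(** Let [chi_1, ..., chi_n] be the characters of [L] with values in a large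
    enough extension of [K], and let [X] be the matrix [(chi_k (xi_i))], so that
    [disc_form xi xi = (\det X)^2]. Splitting the Leibniz formula by the sign of
    the permutation, [\det X = r - r'] while the permanent of [X] is
    [P = r + r'], hence [disc_form xi xi = P^2 - 4 r r'].

    By Ryser's formula [P] is a combination of norms from [L], so it lies in
    [K], and then so does [r r']; both are integral, hence in [A]. If two of the
    [xi_i] coincide then [r = r'] and [P = 2 r], so that [P] modulo [2] is
    alternating and factors through a linear map from [c] to [A / 2 A]. As [c]
    is invertible, this map lifts to the multiplication by some [t] in [c^-1],
    and [t w(xi) = P(xi)] modulo [2] gives [D w(xi)^2 = t^2 w(xi)^2] modulo [4].
    Integral closedness extends this to the products [w(xi) w(eta)], which
    generate [c^2]. *)

Set Implicit Arguments.
Unset Strict Implicit.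
Unset Printing Implicit Defensive.

Import GRing.Theory.
Local Open Scope ring_scope.
Local Open Scope classical_set_scope.

(** * Characters of a commutative algebra *)

(** A reducible [p] has a proper divisor of size above 1, to which induction applies; an irreducible
    one acquires a root by adjunction. *)
Lemma root_extension (K : fieldType) (p : {poly K}) : (1 < size p)%N ->
  exists (E : fieldType) (f : {rmorphism K -> E}) (a : E),
    root (map_poly f p) a.
Proof.
have [m] := ubnP (size p); elim: m p => // m IHm p le_pm p_gt1.
have [irr_p | red_p] := pselect (irreducible_poly p).
  have [E _ [a pa0 _]] := irredp_FAdjoin irr_p.
  by exists E, (in_alg E), a.
have [q q_neq1 [q_p p_neq_q]] :
    exists2 q : {poly K}, size q != 1 & q %| p /\ ~~ (q %= p).
  apply: contrapT => no_q; apply: red_p; split=> // q q_neq1 q_p.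
  by apply: contrapT => /negP qp; apply: no_q; exists q.
have p_neq0 : p != 0 by rewrite -size_poly_gt0 ltnW.
have q_neq0 : q != 0 by apply: contraTneq q_p => ->; rewrite dvd0p.
have lt_qp : (size q < size p)%N.
  by rewrite ltn_neqAle dvdp_leq // andbT (dvdp_size_eqp q_p).
have [||E [f [a qa0]]] := IHm q.
- exact: leq_trans lt_qp _.
- by rewrite ltn_neqAle eq_sym q_neq1 size_poly_gt0.
by exists E, f, a; apply: root_dvdp qa0; rewrite dvdp_map.
Qed.

(** The other matrices commute with [B], hence stabilise an eigenspace of [B]; induction runs on
    their restrictions to it, over a larger field at each stage. *)
Lemma common_eigenvector_ext (K : fieldType) n (As : seq 'M[K]_n) :
    (0 < n)%N -> {in As &, forall B C, comm_mx B C} ->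
  exists (E : fieldType) (f : {rmorphism K -> E}) (v : 'rV[E]_n),
    v != 0 /\ forall B, B \in As -> exists b, v *m map_mx f B = b *: v.
Proof.
have [m] := ubnP (size As).
elim: m K n As => // m IHm K n [_ n_gt0 _ | B As].
  exists K, idfun, (const_mx 1); split=> //.
  apply/eqP=> /rowP/(_ (Ordinal n_gt0)); rewrite !mxE => /eqP.
  by rewrite oner_eq0.
rewrite /= ltnS => le_As_m n_gt0 comm_As.
have [|E1 [f1 [a]]] := @root_extension K (char_poly B).
  by rewrite size_char_poly.
rewrite map_char_poly -eigenvalue_root_char => a_eigen.
pose V := row_base (eigenspace (map_mx f1 B) a).
have VB : V *m map_mx f1 B = a *: V.
  by apply/eigenspaceP; rewrite eq_row_base.
have comm1 C : C \in As -> stablemx V (map_mx f1 C).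
  move=> AsC; rewrite stablemx_row_base; apply: comm_mx_stable_eigenspace.
  rewrite /comm_mx -!map_mxM; congr map_mx.
  by apply: comm_As; rewrite ?mem_head // inE AsC orbT.
pose res (C : 'M[K]_n) := conjmx V (map_mx f1 C).
have resE C : C \in As -> V *m map_mx f1 C = res C *m V.
  by move=> AsC; rewrite mulmxKpV // comm1.
have [|||E2 [f2 [v [v_neq0 vP]]]] := IHm E1 _ [seq res C | C <- As].
- by rewrite size_map.
- by rewrite lt0n mxrank_eq0.
- move=> _ _ /= /mapP[C1 AsC1 ->] /mapP[C2 AsC2 ->].
  rewrite /comm_mx /res -!conjmxM ?inE ?comm1 // -!map_mxM.
  by congr (conjmx _ (map_mx _ _)); apply: comm_As; rewrite inE ?AsC1 ?AsC2 orbT.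
exists E2, (f2 \o f1), (v *m map_mx f2 V); split.
  by rewrite mulmx_free_eq0 // row_free_map row_base_free.
have mapc C : map_mx (f2 \o f1) C = map_mx f2 (map_mx f1 C).
  by apply/matrixP=> i j; rewrite !mxE.
move=> C; rewrite inE => /predU1P[-> | AsC].
  by exists (f2 a); rewrite mapc -mulmxA -map_mxM VB map_mxZ scalemxAr.
have [b vb] := vP (res C) (map_f res AsC).
exists b; rewrite mapc -mulmxA -map_mxM resE // map_mxM mulmxA vb.
by rewrite scalemxAl.
Qed.

(** A common row eigenvector, completed to a basis by [row_ebase], splits off a block of size 1; the
    complementary diagonal blocks still commute. *)
Lemma cotrigonalization_ext (K : fieldType) n (As : seq 'M[K]_n) :
    {in As &, forall B C, comm_mx B C} ->
  exists (E : fieldType) (f : {rmorphism K -> E}) (Q : 'M[E]_n),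
    Q \in unitmx /\
    forall B, B \in As -> is_trig_mx (Q *m map_mx f B *m invmx Q).
Proof.
elim: n K As => [|n IHn] K As comm_As.
  exists K, idfun, 1%:M; split; first exact: unitmx1.
  by move=> B _; apply/is_trig_mxP=> -[].
have [|E1 [f1 [v [v_neq0 vP]]]] := common_eigenvector_ext _ comm_As; first by [].
pose P : 'M_(1 + n) := row_ebase v.
have P_unit : P \in unitmx := row_ebase_unit v.
pose conj (B : 'M[K]_n.+1) : 'M_(1 + n) := P *m map_mx f1 B *m invmx P.
have conjM B C : conj (B *m C) = conj B *m conj C.
  by rewrite /conj map_mxM !mulmxA mulmxKV.
have conj_ur B : B \in As -> ursubmx (conj B) = 0.
  move=> AsB; have [b vb] := vP B AsB.
  have [u u_neq0 def_v] : exists2 u, u != 0 & v = u *: usubmx P.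
    exists (col_ebase v 0 0).
      have := col_ebase_unit v; rewrite [col_ebase v]mx11_scalar unitmxE.
      by rewrite det_scalar1 unitfE mxE.
    rewrite -{1}[v]mulmx_ebase rank_rV v_neq0 [col_ebase v]mx11_scalar.
    rewrite -mulmxA mul_scalar_mx mxE; congr (_ *: _).
    have: row_mx 1%:M 0 *m P = usubmx P.
      by rewrite -{1}[P]vsubmxK mul_row_col mul1mx mul0mx addr0.
    by rewrite -pid_mx_row.
  have Pb : usubmx P *m map_mx f1 B = b *: usubmx P.
    apply: (scalerI u_neq0); rewrite scalemxAl -def_v vb def_v.
    by rewrite !scalerA mulrC.
  rewrite /ursubmx /conj -mulmxA -mul_usub_mx mulmxA Pb -scalemxAl mul_usub_mx.
  rewrite mulmxV // linearZ /=.
  rewrite (_ : rsubmx _ = 0) ?scaler0 //.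
  by rewrite [1%:M]scalar_mx_block; exact: block_mxKur.
have [|E2 [f2 [Q [Q_unit QP]]]] := IHn E1 [seq drsubmx (conj B) | B <- As].
  move=> _ _ /= /mapP[B AsB ->] /mapP[C AsC ->].
  have: conj B *m conj C = conj C *m conj B.
    by rewrite -!conjM; congr conj; apply: comm_As.
  rewrite -[conj B]submxK -[conj C]submxK !mulmx_block !conj_ur //.
  by move/eq_block_mx=> [_ _ _]; rewrite !mulmx0 !add0r !block_mxKdr.
pose R : 'M[E2]_(1 + n) := block_mx 1%:M 0 0 Q.
have R_unit : R \in unitmx by rewrite unitmxE det_ublock det1 mul1r -unitmxE.
have R_inv : invmx R = block_mx 1%:M 0 0 (invmx Q).
  apply: (can_inj (mulKmx R_unit)); rewrite mulmxV // /R mulmx_block.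
  rewrite !(mulmx0, mul0mx, mulmx1, mul1mx, addr0, add0r) mulmxV //.
  by rewrite -scalar_mx_block.
exists E2, (f2 \o f1), (R *m map_mx f2 P); split.
  by rewrite unitmx_mul R_unit map_unitmx.
move=> B AsB.
have -> : map_mx (f2 \o f1) B = map_mx f2 (map_mx f1 B).
  by apply/matrixP=> i j; rewrite !mxE.
have -> : invmx (R *m map_mx f2 P) = map_mx f2 (invmx P) *m invmx R.
  have RP_unit : R *m map_mx f2 P \in unitmx.
    by rewrite unitmx_mul R_unit map_unitmx.
  apply: (can_inj (mulKmx RP_unit)); rewrite mulmxV // mulmxA -(mulmxA R).
  by rewrite -map_mxM mulmxV // map_mx1 mulmx1 mulmxV.
have -> : R *m map_mx f2 P *m map_mx f2 (map_mx f1 B) *m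
      (map_mx f2 (invmx P) *m invmx R) =
    R *m map_mx f2 (conj B) *m invmx R.
  by rewrite /conj !map_mxM !mulmxA.
rewrite R_inv -[conj B]submxK conj_ur // map_block_mx !mulmx_block.
rewrite !(mulmx0, mul0mx, mulmx1, mul1mx, addr0, add0r, map_mx0).
rewrite [is_trig_mx _](@is_trig_block_mx _ 1 n 1 n) //.
rewrite eqxx mx11_is_trig /=; apply: QP.
exact: (map_f (fun C => drsubmx (conj C))).
Qed.

Lemma diag_mul_trig (R : pzRingType) n (B C : 'M[R]_n) i :
  is_trig_mx B -> is_trig_mx C -> (B *m C) i i = B i i * C i i.
Proof.
move=> /is_trig_mxP B_trig /is_trig_mxP C_trig; rewrite mxE (bigD1 i) //=.
rewrite big1 ?addr0 // => j j_neq_i.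
case: (ltngtP i j) => [lt_ij|lt_ji|/val_inj eq_ij].
- by rewrite B_trig // mul0r.
- by rewrite C_trig // mulr0.
- by rewrite eq_ij eqxx in j_neq_i.
Qed.

(* The diagonal entries of the simultaneously triangularised multiplication
   operators; when L is etale these are its embeddings into E. *)
Lemma characters (K : fieldType) (L : falgType K) :
    commutative (@GRing.mul L) ->
  exists (E : fieldType) (f : {rmorphism K -> E})
         (chi : 'I_(\dim {:L}) -> {rmorphism L -> E}),
    let mx x := passmx.mxof (vbasis {:L}) (vbasis {:L}) (amull x) in
    [/\ forall i a x, chi i (a *: x) = f a * chi i x,
        forall x, f (\tr (mx x)) = \sum_i chi i x &
        forall x, f (\det (mx x)) = \prod_i chi i x].
Proof.
move=> mulC; set n := \dim {:L}; pose b := vbasis {:L}.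
pose mx x := passmx.mxof b b (amull x).
have b_basis : basis_of {:L} b := vbasisP _.
have mxL a x y : mx (a *: x + y) = a *: mx x + mx y.
  by rewrite /mx linearP passmx.mxof_linear.
have mxD x y : mx (x + y) = mx x + mx y by rewrite -{1}[x]scale1r mxL scale1r.
have mx0 : mx 0 = 0.
  by apply: (addrI (mx 0)); rewrite -mxD !addr0.
have mxZ a x : mx (a *: x) = a *: mx x by rewrite -[_ *: x]addr0 mxL mx0 addr0.
(* Matrices act on row vectors, which reverses composition; commutativity of [L] restores the
   order. *)
have mxM x y : mx (x * y) = mx x *m mx y.
  apply/row_matrixP=> i; rewrite !rowE mulmxA.
  rewrite !passmx.mul_mxof passmx.rVofK //.
  by rewrite !lfunE /= mulrA [y * x]mulC.
have mx1 : mx 1 = 1%:M.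
  apply/row_matrixP=> i; rewrite !rowE passmx.mul_mxof mulmx1.
  by rewrite lfunE /= mul1r passmx.vecofK.
have [|E [f [Q [Q_unit QP]]]] := @cotrigonalization_ext K n [seq mx x | x <- b].
  move=> _ _ /= /mapP[x _ ->] /mapP[y _ ->].
  by rewrite /comm_mx -!mxM mulC.
pose T x := Q *m map_mx f (mx x) *m invmx Q.
have TD x y : T (x + y) = T x + T y.
  by rewrite /T mxD map_mxD mulmxDr mulmxDl.
have TZ a x : T (a *: x) = f a *: T x.
  by rewrite /T mxZ map_mxZ -scalemxAr -scalemxAl.
have TM x y : T (x * y) = T x *m T y.
  by rewrite /T mxM map_mxM !mulmxA mulmxKV.
have T1 : T 1 = 1%:M by rewrite /T mx1 map_mx1 mulmx1 mulmxV.
(* Only the basis elements were triangularised; linearity extends this to all of [L]. *)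
have T_trig x : is_trig_mx (T x).
  apply/is_trig_mxP=> i j lt_ij; rewrite (coord_vbasis (memvf x)).
  elim/big_rec: _ => [|k y _ IHy].
    by rewrite -(scale0r 0) TZ rmorph0 scale0r mxE.
  rewrite TD TZ mxE IHy addr0 mxE.
  have /QP/is_trig_mxP/(_ i j lt_ij) Tb : mx b`_k \in [seq mx z | z <- b].
    by rewrite map_f // mem_nth // size_tuple.
  by rewrite Tb mulr0.
pose chi i x := T x i i.
have chiB i : zmod_morphism (chi i).
  move=> x y; rewrite /chi -scaleN1r TD TZ rmorphN1 scaleN1r.
  by rewrite mxE; congr (_ + _); rewrite mxE.
have chiM i : monoid_morphism (chi i).
  split; first by rewrite /chi T1 mxE eqxx.
  by move=> x y; rewrite /chi TM diag_mul_trig.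
pose chim i : {rmorphism L -> E} := HB.pack (chi i)
  (GRing.isZmodMorphism.Build L E (chi i) (chiB i))
  (GRing.isMonoidMorphism.Build L E (chi i) (chiM i)).
exists E, f, chim; split=> [i a x|x|x].
- by rewrite /= /chi TZ mxE.
- rewrite -/(mx x) -trace_map_mx.
  by rewrite -[RHS]/(\tr (T x)) /T mxtrace_mulC mulKmx.
- rewrite -/(mx x) -det_map_mx -[RHS]det_trig // /T !det_mulmx mulrAC.
  by rewrite -det_mulmx mulmxV // det1 mul1r.
Qed.

(** * Permanents and integral elements *)

Section Permanent.
Variables (R : comNzRingType) (n : nat).
Implicit Type B : 'M[R]_n.

(** For [b] equal to [false] and [true] these are $r$ and $r'$ of the overview. *)
Definition half_det (b : bool) B : R :=
  \sum_(s : 'S_n | odd_perm s == b) \prod_i B i (s i).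

Definition permanent B : R := \sum_(s : 'S_n) \prod_i B i (s i).

Lemma permanentE B : permanent B = half_det false B + half_det true B.
Proof.
rewrite /permanent (bigID (fun s : 'S_n => odd_perm s == false)) /=.
by congr (_ + _); apply: eq_bigl => s; case: (odd_perm s).
Qed.

Lemma det_half B : \det B = half_det false B - half_det true B.
Proof.
rewrite /determinant (bigID (fun s : 'S_n => odd_perm s == false)) /= -sumrN.
congr (_ + _); first by apply: eq_bigr => s /eqP ->; rewrite expr0 mul1r.
apply: eq_big => s; first by case: (odd_perm s).
by case: (odd_perm s) => // _; rewrite expr1 mulN1r.
Qed.

Lemma permanent_sqr B :
  \det B ^+ 2 = permanent B ^+ 2 - 4%:R * (half_det false B * half_det true B).
Proof. rewrite permanentE det_half; ring. Qed.

(** Inclusion-exclusion on the set of columns: expanding the products of row sums gives a sum over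
    all maps [h] from rows to columns, in which the non-surjective ones cancel. *)
Lemma ryser B :
  permanent B = \sum_(S : {set 'I_n})
    (-1) ^+ #|~: S| * \prod_i \sum_(j in S) B i j.
Proof.
(* The product of these weights over [j] is the sign of the term [S] when [S] contains the image of
   [h], and 0 otherwise. Summed over [S] it factors, with factor 1 at each column in the image and
   $1 - 1$ at the others. *)
pose sg (S : {set 'I_n}) (h : {ffun 'I_n -> 'I_n}) (j : 'I_n) : R :=
  if j \in S then 1 else if j \in codom h then 0 else -1.
transitivity (\sum_(h : {ffun 'I_n -> 'I_n})
    (\sum_(S : {set 'I_n}) \prod_j sg S h j) * \prod_i B i (h i)); last first.
  under eq_bigr => h _ do rewrite mulr_suml.
  rewrite exchange_big; apply: eq_bigr => S _.
  have -> : \prod_i \sum_(j in S) B i j =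
      \prod_i \sum_j (if j \in S then B i j else 0).
    by apply: eq_bigr => i _; rewrite big_mkcond.
  rewrite bigA_distr_bigA mulr_sumr; apply: eq_bigr => h _.
  have [hS | /forallPn[k hk]] := boolP [forall k, h k \in S].
    congr (_ * _); last by apply: eq_bigr => i _; rewrite (forallP hS).
    rewrite -prodr_const [RHS]big_mkcond /=; apply: eq_bigr => j _.
    rewrite /sg inE; case: ifP => //= jS; case: codomP => // -[k def_j].
    by rewrite def_j (forallP hS) in jS.
  rewrite (bigD1 (h k)) //= {1}/sg (negPf hk) codom_f !mul0r.
  by rewrite [X in _ * X](bigD1 k) //= (negPf hk) mul0r mulr0.
under [RHS]eq_bigr => h _ do rewrite -bigA_distr.
rewrite (bigID (fun h : {ffun 'I_n -> 'I_n} => injectiveb h)) /= addrC.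
(* A non-injective [h] misses some column, whose factor is zero. *)
rewrite big1 ?add0r => [|h /injectivePn[i1 [i2 i12 eq_h]]]; last first.
  have [j /negPf jh] : exists j, j \notin codom h.
    apply/existsP; rewrite -negb_forall; apply/negP => /forallP h_surj.
    have /card_uniqP : #|codom h| = size (codom h).
      rewrite size_codom; apply: eq_card => j.
      by rewrite h_surj.
    by move/injectiveP/(_ i1 i2 eq_h)/eqP; rewrite (negPf i12).
  by rewrite (bigD1 j) //= jh subrr !mul0r.
rewrite (reindex (@pval _)) /=; last first.
  pose in_Sn := insubd (1%g : 'S_n).
  by exists in_Sn => /= f Uf; first apply: val_inj; apply: insubdK.
apply: eq_big => /= [s | s _]; first by rewrite (valP s).
rewrite [X in _ = X * _]big1 ?mul1r; first by apply: eq_bigr => i _; rewrite pvalE.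
move=> j _; case: ifP => [_|/negP[]]; first by rewrite addr0.
by apply/codomP; exists (s^-1 j)%g; rewrite pvalE permKV.
Qed.
End Permanent.

(** The determinant trick: [x] is a root of a characteristic polynomial over [R]. The matrix is
    transposed because eigenvectors are rows. *)
Lemma integral_eigenvector (R : comNzRingType) (E : fieldType)
    (f : {rmorphism R -> E}) m (v : 'I_m -> E) (M : 'I_m -> 'I_m -> R) (x : E) i0 :
  v i0 != 0 -> (forall i, x * v i = \sum_j f (M i j) * v j) ->
  integralOver f x.
Proof.
move=> v_neq0 xv; pose B : 'M[R]_m := \matrix_(i, j) M j i.
exists (char_poly B); first exact: char_poly_monic.
rewrite map_char_poly -eigenvalue_root_char; apply/eigenvalueP.
exists (\row_i v i); last first.
  by apply: contraNneq v_neq0 => /rowP/(_ i0); rewrite !mxE => ->.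
apply/rowP=> i; rewrite !mxE xv; apply: eq_bigr => j _.
by rewrite !mxE mulrC.
Qed.

Lemma integral_sum (R K : comNzRingType) (f : {rmorphism R -> K})
    (I : Type) (r : seq I) (P : pred I) (F : I -> K) :
    (forall i, P i -> integralOver f (F i)) ->
  integralOver f (\sum_(i <- r | P i) F i).
Proof.
by move=> intF; elim/big_ind: _ => //; [exact: integral0|exact: integral_add].
Qed.

Lemma integral_prod (R K : comNzRingType) (f : {rmorphism R -> K})
    (I : Type) (r : seq I) (P : pred I) (F : I -> K) :
    (forall i, P i -> integralOver f (F i)) ->
  integralOver f (\prod_(i <- r | P i) F i).
Proof.
by move=> intF; elim/big_ind: _ => //; [exact: integral1|exact: integral_mul].
Qed.

(** Since [f] is injective, an integral equation for [f x] already holds for [x]; this brings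
    integrality proved in [E] back to the fraction field. *)
Lemma integrally_closed_ext (A : idomainType) (E : fieldType)
    (f : {rmorphism {fraction A} -> E}) (x : {fraction A}) :
  integrally_closed A -> integralOver (f \o @FracField.tofrac A) (f x) ->
  exists a : A, x = a%:F.
Proof.
move=> intA [p p_monic px]; apply: intA; exists p => //.
by move: px; rewrite map_poly_comp fmorph_root.
Qed.

(** * Invertibility of fractional ideals *)

Lemma submodule_sum (R : comNzRingType) (M : lmodType R) (S : set M)
    (m : nat) (u : 'I_m -> M) :
  submodule S -> (forall i, S (u i)) -> S (\sum_i u i).
Proof. by move=> [S0 SD _] Su; elim/big_ind: _. Qed.

Lemma span_of_generator (R : comNzRingType) (M : lmodType R) (m : nat)
    (g : 'I_m -> M) i : span_of g (g i).
Proof.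
exists (fun j => (j == i)%:R); rewrite (bigD1 i) //= eqxx scale1r.
by rewrite big1 ?addr0 // => j /negPf ->; rewrite scale0r.
Qed.

Section Ideals.
Variable A : idomainType.
Implicit Types (I J : set A) (F : set (set A)).

Lemma idealI I : I 0 -> (forall a b : A, I a -> I b -> I (a + b)) ->
  (forall a b : A, I b -> I (a * b)) -> ideal I.
Proof. by move=> I0 ID IM; split. Qed.

Lemma ideal_generators I : noetherian A -> ideal I ->
  exists m (g : 'I_m -> A), (forall i, I (g i)) /\
    forall x, I x -> exists e : 'I_m -> A, x = \sum_i e i * g i.
Proof.
move=> noethA /noethA[m [g ->]]; exists m, g.
by split=> // i; apply: span_of_generator.
Qed.

(** Otherwise choice yields a strictly increasing chain in [F]; its union is finitely generated, so
    one term contains all the generators and the chain stops there. *)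
Lemma noetherian_maximal F : noetherian A -> (forall I, F I -> ideal I) ->
    (exists I, F I) ->
  exists2 I, F I & forall J, F J -> I `<=` J -> J = I.
Proof.
move=> noethA idealF [I0 FI0]; apply: contrapT => no_max.
have step (I : {I | F I}) :
    {J : {J | F J} | sval I `<=` sval J /\ sval J <> sval I}.
  apply/cid; apply: contrapT => no_J; apply: no_max.
  exists (sval I); first exact: (svalP I).
  move=> J FJ le_IJ; apply: contrapT => neq_JI; apply: no_J.
  by exists (exist _ J FJ).
pose chain k := iter k (fun X => sval (step X)) (exist _ I0 FI0).
have chainS k : sval (chain k) `<=` sval (chain k.+1).
  exact: (svalP (step (chain k))).1.
have chain_le k l : (k <= l)%N -> sval (chain k) `<=` sval (chain l).
  move/subnKC <-; elim: (l - k)%N => [|d IHd]; first by rewrite addn0.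
  by rewrite addnS => x /IHd; apply: chainS.
have chain_ideal k : ideal (sval (chain k)) by apply/idealF/(svalP (chain k)).
pose U : set A := [set x | exists k, sval (chain k) x].
have U_ideal : ideal U.
  split=> [|x y [k kx] [l ly]|a x [k kx]].
  - by exists 0; case: (chain_ideal 0).
  - exists (maxn k l); have [_ addP _] := chain_ideal (maxn k l).
    by apply: addP; [move: kx|move: ly]; apply: chain_le;
      rewrite ?leq_maxl ?leq_maxr.
  - by exists k; have [_ _ mulP] := chain_ideal k; apply: mulP.
have [m [g [gU genU]]] := ideal_generators noethA U_ideal.
pose N i := sval (cid (gU i)).
have gN i : sval (chain (\max_j N j)) (g i).
  apply: (@chain_le (N i)); first exact: (leq_bigmax i).
  exact: (svalP (cid (gU i))).
have [le_N neq_N] := svalP (step (chain (\max_j N j))).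
apply: neq_N; rewrite eqEsubset; split=> // x xN.
have : U x by exists (\max_j N j).+1.
case/genU=> a ->; apply: (submodule_sum (chain_ideal _)) => i.
by have [_ _ mulP] := chain_ideal (\max_j N j); apply: mulP.
Qed.

(** A maximal element among the proper ideals containing [J] is prime. *)
Lemma prime_ideal_above J : noetherian A -> ideal J -> ~ J 1 ->
  exists2 p, prime_ideal p & J `<=` p.
Proof.
move=> noethA J_ideal J1.
have [||p [p_ideal p1 le_Jp] p_max] :=
  @noetherian_maximal [set I | [/\ ideal I, ~ I 1 & J `<=` I]] noethA.
- by move=> I [].
- by exists J; split => // x.
exists p => //; split=> // a b pab.
have [p0 pD pM] := p_ideal.
have [pa | npa] := pselect (p a); [by left | right].
pose I : set A := [set x | exists q r : A, p q /\ x = q + r * a].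
have I_ideal : ideal I.
  apply: idealI => [|x y [q [r [pq ->]]] [q' [r' [pq' ->]]]|c x [q [r [pq ->]]]].
  - by exists 0, 0; rewrite mul0r addr0.
  - exists (q + q'), (r + r'); split; first exact: pD.
    by rewrite mulrDl addrACA.
  - exists (c * q), (c * r); split; first exact: pM.
    by rewrite mulrDr mulrA.
have le_pI : p `<=` I by move=> x px; exists x, 0; rewrite mul0r addr0.
(* [I] is $p + aA$; were it proper, maximality would put [a] in [p]. *)
have [q [r [pq def1]]] : I 1.
  apply: contrapT => nI1; apply: npa.
  have <- : I = p by apply: p_max => //; split=> // x /le_Jp/le_pI.
  by exists 0, 1; rewrite mul1r add0r.
have -> : b = b * q + r * (a * b) by rewrite -[LHS]mulr1 def1; ring.
by apply: pD; apply: pM.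
Qed.

(* A maximal colon ideal [(a : b)] among those contained in the prime [p]
   is prime, hence equal to [p]; the witness is then [x = b / a]. *)
Lemma proper_ideal_inverse J a : dedekind_domain A ->
    ideal J -> ~ J 1 -> J a -> a != 0 ->
  exists2 x : {fraction A},
    forall y, J y -> exists z : A, x * y%:F = z%:F & ~ exists z : A, x = z%:F.
Proof.
move=> [noethA _ dimA] J_ideal J1 Ja a_neq0.
have [p [p_ideal p1 pP] le_Jp] := prime_ideal_above noethA J_ideal J1.
pose colon (b : A) : set A := [set r | exists s, r * b = s * a].
have colon_ideal b : ideal (colon b).
  apply: idealI => [|r r' [s rb] [s' rb']|c r [s rb]].
  - by exists 0; rewrite !mul0r.
  - by exists (s + s'); rewrite !mulrDl rb rb'.
  - by exists (c * s); rewrite -!mulrA -rb.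
have colon_a b : colon b a by exists b; rewrite mulrC.
have [||_ [b le_bp ->] b_max] :=
  @noetherian_maximal [set I | exists2 b, colon b `<=` p & I = colon b] noethA.
- by move=> I [b _ ->].
(* [colon 1] is the principal ideal $aA$, contained in [J] and so in [p]. *)
- exists (colon 1), 1 => // r [s]; rewrite mulr1 => ->.
  by have [_ _ pM] := p_ideal; apply: pM; apply: le_Jp.
have b_prime : prime_ideal (colon b).
  split=> // [/le_bp//|x y xyb].
  have [yb | nyb] := pselect (colon b y); [by right | left].
  (* If [colon (y * b)] lies in [p], it equals [colon b] by maximality and contains [x]. Otherwise
     some [s] in it is outside [p]; primality of [p] puts [colon (s * b)] inside [p], so it equals
     [colon b], yet it contains [y]. *)
  have [le_ybp | /existsNP[s /not_implyP[[u syb] nps]]] :=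
    pselect (colon (y * b) `<=` p).
    rewrite -(b_max (colon (y * b))).
    + by have [s xys] := xyb; exists s; rewrite mulrA.
    + by exists (y * b).
    + by move=> r [s rb]; exists (y * s); rewrite mulrCA rb mulrA.
  have le_sbp : colon (s * b) `<=` p.
    move=> r [v rsb]; have /le_bp/pP[] // : colon b (r * s).
    by exists v; rewrite -mulrA.
  case: nyb; rewrite -(b_max (colon (s * b))).
  + by exists u; rewrite mulrCA.
  + by exists (s * b).
  + by move=> r [v rb]; exists (s * v); rewrite mulrCA rb mulrA.
have [_ _ b_maximal] : maximal_ideal (colon b).
  apply: dimA => // b0; have := colon_a b; rewrite b0 /= => /eqP.
  by rewrite (negPf a_neq0).
have def_p : p = colon b.
  by have [//|pT] := b_maximal p p_ideal le_bp; rewrite pT in p1; case: p1.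
have aF_neq0 : a%:F != 0 by rewrite tofrac_eq0.
exists (b%:F / a%:F) => [y /le_Jp | [z /(canRL (divfK aF_neq0)) /eqP]].
  rewrite def_p => -[z yb]; exists z; apply: (mulIf aF_neq0).
  by rewrite -[RHS]rmorphM -yb rmorphM mulrAC divfK // mulrC.
rewrite -rmorphM tofrac_eq => /eqP def_b; apply: p1; rewrite def_p.
by exists z; rewrite mul1r.
Qed.

End Ideals.

(** If $c c^{-1}$ were proper, some [z] outside [A] would multiply it into [A]. Then [z] maps
    $c^{-1}$ to itself, which makes it integral over [A], a contradiction. *)
Lemma fractional_ideal_invertible (A : idomainType) (c : set {fraction A}) :
  dedekind_domain A -> fractional_ideal c -> fideal_mul c (fideal_inv c) 1.
Proof.
move=> dedA [[c0 cD cM] [x cx x_neq0] [d d_neq0 cd]].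
have dF_neq0 : d%:F != 0 by rewrite tofrac_eq0.
have inv_d : fideal_inv c d%:F by [].
have invD u v : fideal_inv c u -> fideal_inv c v -> fideal_inv c (u + v).
  move=> cu cv y cy; have [a ua] := cu y cy; have [b vb] := cv y cy.
  by exists (a + b); rewrite mulrDl ua vb rmorphD.
have invM a u : fideal_inv c u -> fideal_inv c (a%:F * u).
  move=> cu y cy; have [b ub] := cu y cy.
  by exists (a * b); rewrite -mulrA ub rmorphM.
have inv0 : fideal_inv c 0 by move=> y _; exists 0; rewrite mul0r rmorph0.
pose J : set A := [set a | fideal_mul c (fideal_inv c) a%:F].
suff: J 1 by rewrite /J /= rmorph1.
have prodJ y v : c y -> fideal_inv c v -> exists2 a, J a & y * v = a%:F.
  move=> cy cv; have [a va] := cv y cy; exists a; last by rewrite mulrC.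
  exists 1%N, (fun=> y), (fun=> v); split=> //.
  by rewrite big_ord1 mulrC va.
have J_ideal : ideal J.
  apply: idealI => [|a b [m [u [v [cu cv def_a]]]] [m' [u' [v' [cu' cv' def_b]]]]|a b].
  - by exists 0%N, (fun=> 0), (fun=> 0); split=> //; rewrite big_ord0 rmorph0.
  - pose s i := match split i with inl j => u j | inr j => u' j end.
    pose t i := match split i with inl j => v j | inr j => v' j end.
    exists (m + m')%N, s, t; split.
    + by move=> i; rewrite /s; case: split.
    + by move=> i; rewrite /t; case: split.
    + rewrite tofracD def_a def_b big_split_ord /=; congr (_ + _).
        by apply: eq_bigr => i _; rewrite /s /t (unsplitK (inl i)).
      by apply: eq_bigr => i _; rewrite /s /t (unsplitK (inr i)).
  - move=> [m [u [v [cu cv def_b]]]]; exists m, u, (fun i => a%:F * v i).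
    split=> // [i|]; first exact: invM.
    rewrite tofracM def_b mulr_sumr; apply: eq_bigr => i _.
    by rewrite mulrCA.
apply: contrapT => J1.
have [a Ja def_a] := prodJ x d%:F cx inv_d.
have a_neq0 : a != 0 by rewrite -tofrac_eq0 -def_a mulf_neq0.
have [z zJ zA] := proper_ideal_inverse dedA J_ideal J1 Ja a_neq0.
have z_inv v : fideal_inv c v -> fideal_inv c (z * v).
  move=> cv y cy; have [b Jb yv] := prodJ y v cy cv.
  by have [e ze] := zJ b Jb; exists e; rewrite -mulrA [v * y]mulrC yv.
case: dedA => noethA intA _; apply: zA; apply: intA.
(* The copy $x c^{-1}$ of $c^{-1}$ lies in [A], so the noetherian hypothesis gives it finitely many
   generators. *)
pose I : set A := [set b | exists2 v, fideal_inv c v & b%:F = x * v].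
have I_ideal : ideal I.
  apply: idealI => [|b b' [v cv ebv] [v' cv' ebv']|e b [v cv ebv]].
  - by exists 0; rewrite // rmorph0 mulr0.
  - by exists (v + v'); rewrite ?tofracD ?ebv ?ebv' ?mulrDr //; apply: invD.
  - by exists (e%:F * v); [exact: invM | rewrite tofracM ebv mulrCA].
have [m [g [gI genI]]] := ideal_generators noethA I_ideal.
have zg i : exists M : 'I_m -> A, z * (g i)%:F = \sum_j (M j)%:F * (g j)%:F.
  have [v cv def_g] := gI i; have [e ev] := z_inv v cv x cx.
  have : I e by exists (z * v); [exact: z_inv | rewrite [RHS]mulrC ev].
  case/genI=> M def_e; exists M.
  rewrite def_g mulrCA mulrC ev def_e rmorph_sum.
  by apply: eq_bigr => j _; rewrite -rmorphM.
have [M zM] := choice zg.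
have [i0 gi0] : exists i0, (g i0)%:F != 0 :> {fraction A}.
  apply: contrapT => /forallNP g0.
  have : I a by exists d%:F.
  case/genI=> e def_a'; case/eqP: a_neq0; rewrite def_a'.
  apply: big1 => i _; have /negP/negPn := g0 i; rewrite tofrac_eq0 => /eqP ->.
  exact: mulr0.
exact: (integral_eigenvector gi0 zM).
Qed.

(** * Quotient modules and exterior powers *)

Section QuotientModule.
Local Open Scope quotient_scope.
Variables (R : comNzRingType) (M : lmodType R) (S : set M).
Hypothesis S_sub : submodule S.

Definition submodule_pred : {pred M} := fun x => `[< S x >].

Lemma submodule_predP x : reflect (S x) (x \in submodule_pred).
Proof. exact: asboolP. Qed.

Fact submodule_zmod_closed : zmod_closed submodule_pred.
Proof.
have [S0 SD SZ] := S_sub; split=> [|x y]; first exact/submodule_predP.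
move=> /submodule_predP Sx /submodule_predP Sy; apply/submodule_predP.
by apply: SD => //; rewrite -scaleN1r; apply: SZ.
Qed.

HB.instance Definition _ := GRing.isZmodClosed.Build M submodule_pred
  submodule_zmod_closed.

Let Q := Quotient.quot submodule_pred.

Lemma pi_quotient_eq x y : S (x - y) -> \pi_Q x = \pi_Q y.
Proof.
by move=> /submodule_predP Sxy; apply/eqP; rewrite -Quotient.idealrBE.
Qed.

Definition quotient_scale (a : R) (q : Q) : Q :=
  \pi_Q (a *: generic_quotient.repr q).

Lemma quotient_scale_pi a x : quotient_scale a (\pi_Q x) = \pi_Q (a *: x).
Proof.
have [_ _ SZ] := S_sub; apply: pi_quotient_eq; rewrite -scalerBr; apply: SZ.
by apply/submodule_predP; rewrite Quotient.idealrBE reprK.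
Qed.

Fact quotient_scaleA a b q :
  quotient_scale a (quotient_scale b q) = quotient_scale (a * b) q.
Proof. by rewrite -[q]reprK !quotient_scale_pi reprK scalerA. Qed.

Fact quotient_scale1 : left_id 1 quotient_scale.
Proof. by move=> q; rewrite -[q]reprK quotient_scale_pi scale1r. Qed.

Fact quotient_scaleDr : right_distributive quotient_scale +%R.
Proof.
move=> a q r; rewrite -[q]reprK -[r]reprK -raddfD !quotient_scale_pi -raddfD.
by rewrite scalerDr.
Qed.

Fact quotient_scaleDl q : {morph quotient_scale^~ q : a b / a + b}.
Proof.
by move=> a b; rewrite -[q]reprK !quotient_scale_pi -raddfD scalerDl.
Qed.

HB.instance Definition _ :=
  GRing.Zmodule_isLmodule.Build R (Quotient.quot submodule_pred)
  quotient_scaleA quotient_scale1 quotient_scaleDr quotient_scaleDl.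

(** Quotients serve as targets for the universal property of exterior powers. *)
Lemma submodule_quotient : exists (Q : lmodType R) (pi : M -> Q),
  [/\ linear pi, forall x, pi x = 0 <-> S x & forall q, exists x, pi x = q].
Proof.
exists Q, (\pi_Q); split=> [a x y|x|q].
- by rewrite raddfD; congr (_ + _); rewrite -[LHS]quotient_scale_pi.
- have pi0 : \pi_Q 0 = 0 :> Q by exact: raddf0.
  split=> [pix0|Sx]; last by rewrite -pi0; apply: pi_quotient_eq; rewrite subr0.
  apply/submodule_predP; rewrite -[x]subr0 Quotient.idealrBE.
  by apply/eqP; rewrite pi0.
- by exists (generic_quotient.repr q); rewrite reprK.
Qed.

End QuotientModule.

(** Uniqueness in the universal property: the projection modulo [W] and the zero map agree on all
    [w xi], hence on [T]. *)
Lemma exterior_power_span (R : comNzRingType) (M N : lmodType R) (n : nat)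
    (S : set M) (T : set N) (w : ('I_n -> M) -> N) (W : set N) :
    exterior_power S T w -> submodule W ->
  (forall xi, family_in S xi -> W (w xi)) -> T `<=` W.
Proof.
move=> [_ _ univ] W_sub wW y Ty.
have [Q [pi [piL pi0 _]]] := submodule_quotient W_sub.
have zero_alt : alternating_on S (fun _ : 'I_n -> M => 0 : Q).
  by split=> // *; rewrite scaler0 addr0.
have [g [_ _ g_uniq]] := univ Q _ zero_alt.
apply/pi0; transitivity (g y).
  apply: g_uniq => // [a x z _ _|xi Sxi]; first exact: piL.
  by apply/esym/pi0/wW.
apply/esym; apply: (g_uniq (fun=> 0)) => // a x z _ _.
by rewrite scaler0 addr0.
Qed.

Lemma linear_on_sum (R : comNzRingType) (N N' : lmodType R) (T : set N)
    (g : N -> N') m (a : 'I_m -> R) (u : 'I_m -> N) :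
    submodule T -> linear_on T g -> (forall i, T (u i)) ->
  g (\sum_i a i *: u i) = \sum_i a i *: g (u i).
Proof.
move=> [T0 TD TZ] gL Tu.
have g0 : g 0 = 0.
  by apply: (addrI (g 0)); rewrite -{1}[g 0]scale1r -gL // scale1r !addr0.
have [] // : T (\sum_i a i *: u i) /\ g (\sum_i a i *: u i) = \sum_i a i *: g (u i).
elim/big_rec2: _ => [//|i y x _ [Tx <-]]; split; last exact: gL.
by apply: TD => //; apply: TZ.
Qed.

(** * The discriminant of an order *)

(** An element of [L] is determined by its images in the fields [F i], where products commute. *)
Lemma etale_commutative (K : fieldType) (L : falgType K) :
  etale L -> commutative (@GRing.mul L).
Proof.
move=> [r [F [f [_ f_bij]]]] x y.
have [z [_ z_uniq]] := f_bij (fun i => f i x * f i y).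
rewrite -(z_uniq (x * y)); last by move=> i; rewrite rmorphM.
by apply: z_uniq => i; rewrite rmorphM mulrC.
Qed.

Section Permanents.
Variables (A : idomainType) (L : falgType {fraction A}) (O : set L).
Local Notation K := {fraction A}.
Local Notation n := (\dim {:L}).
Variables (E : fieldType) (f : {rmorphism K -> E})
  (chi : 'I_n -> {rmorphism L -> E}).
Hypothesis chiZ : forall i a x, chi i (a *: x) = f a * chi i x.
Hypothesis chi_tr : forall x, f (alg_trace x) = \sum_i chi i x.
Hypothesis chi_det : forall x,
  f (\det (passmx.mxof (vbasis {:L}) (vbasis {:L}) (amull x))) = \prod_i chi i x.

Definition chi_mx (xi : 'I_n -> L) : 'M[E]_n := \matrix_(k, i) chi k (xi i).

Lemma disc_form_chi xi eta :
  f (disc_form xi eta) = \det (chi_mx xi) * \det (chi_mx eta).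
Proof.
rewrite -(det_tr (chi_mx xi)) -det_mulmx -det_map_mx; congr (\det _).
apply/matrixP=> i j; rewrite !mxE chi_tr; apply: eq_bigr => k _.
by rewrite !mxE rmorphM.
Qed.

(** In the formula of [ryser] the row sums over [S] are the characters of a single element of [L],
    so their product is its norm. *)
Lemma permanent_rational xi : exists p : K, f p = permanent (chi_mx xi).
Proof.
exists (\sum_(S : {set 'I_n}) (-1) ^+ #|~: S| *
  \det (passmx.mxof (vbasis {:L}) (vbasis {:L}) (amull (\sum_(i in S) xi i)))).
rewrite ryser rmorph_sum; apply: eq_bigr => S _.
rewrite rmorphM rmorph_sign /= chi_det; congr (_ * _); apply: eq_bigr => k _.
by rewrite rmorph_sum; apply: eq_bigr => i _; rewrite mxE.
Qed.

(** Each term of the permanent has exactly one factor from column [i], in row [s^-1 i]. *)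
Lemma permanent_linear xi i (a : K) x y :
  permanent (chi_mx (upd xi i (a *: x + y))) =
    f a * permanent (chi_mx (upd xi i x)) + permanent (chi_mx (upd xi i y)).
Proof.
have expand z : permanent (chi_mx (upd xi i z)) = \sum_(s : 'S_n)
    chi (s^-1 i)%g z * \prod_(k | k != (s^-1 i)%g) chi k (xi (s k)).
  apply: eq_bigr => s _; rewrite (bigD1 (s^-1 i)%g) //= mxE permKV /upd eqxx.
  congr (_ * _); apply: eq_bigr => k k_neq; rewrite mxE.
  by rewrite -(inj_eq (@perm_inj _ s^-1)) permK (negPf k_neq).
rewrite !expand mulr_sumr -big_split /=; apply: eq_bigr => s _.
by rewrite rmorphD chiZ; ring.
Qed.

Hypothesis O_order : is_order n O.
Hypothesis intA : integrally_closed A.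
Hypothesis two_neq0 : 2%:R != 0 :> K.

(** Multiplication by [x] preserves [O], so the values of [chi k] on generators of [O] form an
    eigenvector; it is nonzero because [O] contains 1. *)
Lemma chi_integral k x : O x -> integralOver (f \o @FracField.tofrac A) (chi k x).
Proof.
case: O_order => O1 _ OM [_ [m [g defO]] _] Ox.
have gO i : O (g i) by rewrite defO; apply: span_of_generator.
have xg i : exists M : 'I_m -> A,
    chi k x * chi k (g i) = \sum_j f (M j)%:F * chi k (g j).
  have := OM x (g i) Ox (gO i); rewrite {1}defO => -[M def_xg]; exists M.
  rewrite -rmorphM def_xg rmorph_sum; apply: eq_bigr => j _; exact: chiZ.
have [M xM] := choice xg.
have [i0 gi0] : exists i0, chi k (g i0) != 0.
  apply: contrapT => /forallNP g0; move: O1; rewrite defO => -[e def1].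
  have /eqP := oner_neq0 E; apply; rewrite -(rmorph1 (chi k)) def1 rmorph_sum.
  apply: big1 => i _; apply: etrans (chiZ _ _ _) _.
  by have /negP/negPn/eqP -> := g0 i; rewrite mulr0.
exact: (@integral_eigenvector A E (f \o @FracField.tofrac A) m
  (fun j => chi k (g j)) M _ i0).
Qed.

Lemma half_det_integral b xi : (forall i, O (xi i)) ->
  integralOver (f \o @FracField.tofrac A) (half_det b (chi_mx xi)).
Proof.
move=> Oxi; apply: integral_sum => s _; apply: integral_prod => k _.
by rewrite mxE; apply: chi_integral.
Qed.

Lemma permanent_integral xi : (forall i, O (xi i)) ->
  exists a : A, f a%:F = permanent (chi_mx xi).
Proof.
move=> Oxi; have [p fp] := permanent_rational xi.
have [|a def_p] := @integrally_closed_ext A E f p intA.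
  by rewrite fp permanentE; apply: integral_add; apply: half_det_integral.
by exists a; rewrite -def_p.
Qed.

Lemma disc_form_permanent xi a : (forall i, O (xi i)) ->
    f a%:F = permanent (chi_mx xi) ->
  exists b : A, disc_form xi xi = a%:F ^+ 2 - 4%:R * b%:F.
Proof.
(* Dividing by 4 defines [q] in the fraction field; [f q] is then $r r'$, which is integral. *)
move=> Oxi fa; pose q := (a%:F ^+ 2 - disc_form xi xi) / 4%:R.
have four_neq0 : 4%:R != 0 :> K by rewrite (natrM _ 2 2) mulf_neq0.
have def_q : disc_form xi xi = a%:F ^+ 2 - 4%:R * q by rewrite /q; field.
have [|b def_b] := @integrally_closed_ext A E f q intA; last first.
  by exists b; rewrite -def_b.
suff -> : f q = half_det false (chi_mx xi) * half_det true (chi_mx xi).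
  by apply: integral_mul; apply: half_det_integral.
apply: (@mulfI _ (f 4%:R)); first by rewrite fmorph_eq0.
have : f (disc_form xi xi) = f (a%:F ^+ 2 - 4%:R * q) by rewrite -def_q.
rewrite disc_form_chi -expr2 permanent_sqr rmorphB rmorphXn rmorphM /= fa.
by move/addrI/oppr_inj => <-; rewrite rmorph_nat.
Qed.

Lemma permanent_alternating xi i j a : (forall i, O (xi i)) ->
    i != j -> xi i = xi j -> f a%:F = permanent (chi_mx xi) ->
  exists b : A, a = 2%:R * b.
Proof.
move=> Oxi i_neq_j xi_ij fa.
have : \det (chi_mx xi) = 0.
  rewrite -det_tr; apply: (determinant_alternate i_neq_j) => k.
  by rewrite !mxE xi_ij.
rewrite det_half => /eqP; rewrite subr_eq0 => /eqP def_r.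
(* The image of [a / 2] under [f] is the common value of the two half sums. *)
have [|b def_b] := @integrally_closed_ext A E f (a%:F / 2%:R) intA.
  suff -> : f (a%:F / 2%:R) = half_det true (chi_mx xi) by exact: half_det_integral.
  rewrite fmorph_div /= fa permanentE def_r.
  apply: (canLR (mulfK _)); first by rewrite fmorph_eq0.
  by rewrite rmorph_nat mulr_natr mulr2n.
exists b; apply/eqP; rewrite -tofrac_eq tofracM -def_b rmorph_nat mulrC.
by rewrite divfK.
Qed.

End Permanents.

Lemma order_permanent (A : idomainType) (L : falgType {fraction A}) (O : set L)
    (n := \dim {:L}) :
    integrally_closed A -> 2%:R != 0 :> {fraction A} ->
    commutative (@GRing.mul L) -> is_order n O ->
  exists P : ('I_n -> L) -> A,
    [/\ forall xi, (forall i, O (xi i)) -> exists b : A,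
          disc_form xi xi = (P xi)%:F ^+ 2 - 4%:R * b%:F,
        forall xi i (a : A) x y, (forall i, O (xi i)) -> O x -> O y ->
          P (upd xi i (a%:F *: x + y)) = a * P (upd xi i x) + P (upd xi i y) &
        forall xi i j, (forall i, O (xi i)) -> i != j -> xi i = xi j ->
          exists b : A, P xi = 2%:R * b].
Proof.
move=> intA two_neq0 mulC O_order.
have [E [f [chi [chiZ chi_tr chi_det]]]] := characters mulC.
have /choice[P defP] : forall xi : 'I_n -> L, exists a : A,
    (forall i, O (xi i)) -> f a%:F = permanent (chi_mx chi xi).
  move=> xi; have [Oxi|nOxi] := pselect (forall i, O (xi i)); last by exists 0.
  (* Outside [O] the chosen value is the arbitrary default 0. *)
  by have [a fa] := permanent_integral chiZ chi_det O_order intA Oxi; exists a.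
exists P; split=> [xi Oxi|xi i a x y Oxi Ox Oy|xi i j Oxi ij xi_ij].
- exact: (disc_form_permanent chiZ chi_tr O_order intA two_neq0 Oxi (defP xi Oxi)).
- have Oupd z : O z -> forall j, O (upd xi i z j).
    by move=> Oz j; rewrite /upd; case: ifP.
  have Oaxy : O (a%:F *: x + y).
    by case: O_order => _ _ _ [[_ OD OZ] _] _; apply: OD => //; apply: OZ.
  apply/eqP; rewrite -tofrac_eq tofracD tofracM; apply/eqP/(fmorph_inj f).
  rewrite rmorphD rmorphM /= !defP; do ?[exact: Oupd].
  exact: permanent_linear.
- exact: (permanent_alternating chiZ O_order intA two_neq0 Oxi ij xi_ij (defP xi Oxi)).
Qed.

Lemma principal_quotient (A : idomainType) (r : A) :
  exists (Q : lmodType A) (pi : A -> Q),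
    [/\ forall a x y, pi (a * x + y) = a *: pi x + pi y,
        forall x, pi x = 0 <-> (exists b : A, x = r * b) &
        forall q, exists x, pi x = q].
Proof.
have S_sub : ideal [set x | exists b : A, x = r * b].
  apply: idealI => [|_ _ [a ->] [b ->]|a _ [b ->]].
  - by exists 0; rewrite mulr0.
  - by exists (a + b); rewrite mulrDr.
  - by exists (a * b); rewrite mulrCA.
exact: submodule_quotient S_sub.
Qed.

Lemma square_integral (A : idomainType) (x : {fraction A}) (a : A) :
  integrally_closed A -> x ^+ 2 = a%:F -> exists b : A, x = b%:F.
Proof.
move=> intA x2; apply: intA; exists ('X^2 - a%:P); first exact: monicXnsubC.
by rewrite rmorphB /= map_polyXn map_polyC /root !hornerE x2 subrr.
Qed.

Theorem lemma3p2 (A : idomainType) (L : falgType {fraction A}) (n : nat)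
    (O : set L) (c : set {fraction A}) (D : {fraction A}) :
  dedekind_domain A ->
  2%N \notin [pchar {fraction A}] ->
  etale L ->
  is_order n O ->
  is_discriminant n O c D ->
  exists2 t : {fraction A}, fideal_inv c t &
    congr_mod D (t ^+ 2) 4%:R (fideal_inv2 c).
Proof.
move=> dedA; rewrite inE /= => two_neq0 /etale_commutative mulC O_order.
have def_n : n = \dim {:L}.
  by case: O_order => _ _ _ _ [b /size_basis ->].
subst n => -[c_frac [w w_ext w_disc]].
have intA : integrally_closed A by case: dedA.
have [P [P_disc P_lin P_alt]] := order_permanent intA two_neq0 mulC O_order.
have c_sub : submodule (c : set (restr {fraction A}^o)) by case: c_frac.
have [Q [pi [piL pi0 pi_surj]]] := principal_quotient (2%:R : A).
have [_ _ univ] := w_ext.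
(* The permanent modulo 2 is alternating and induces [g] from [c] to $A / 2A$. *)
have [|g [gL gw _]] := univ Q (fun xi => pi (P xi)).
  split=> [xi i a x y Oxi Ox Oy|xi i j Oxi ij xi_ij].
    by rewrite -piL; congr pi; apply: P_lin.
  by apply/pi0; apply: P_alt Oxi ij xi_ij.
have [m [u [v [cu cv def1]]]] := fractional_ideal_invertible dedA c_frac.
have [a pi_a] := choice (fun i => pi_surj (g (u i))).
(* Here $1 = \sum_i u_i v_i$ and [a i] lifts [g (u i)]. For [y] in [c], $y = \sum_i (v_i y) u_i$
   with coefficients in [A], so $t y$ lifts [g y]. *)
pose t := \sum_i v i * (a i)%:F.
have tP y : c y -> exists s : A, t * y = s%:F /\ pi s = g y.
  move=> cy; have [e ve] := choice (fun i => cv i y cy).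
  exists (\sum_i e i * a i); split.
    rewrite rmorph_sum mulr_suml; apply: eq_bigr => i _.
    by rewrite /= tofracM -ve mulrAC.
  have -> : y = \sum_i (e i *: (u i : restr {fraction A}^o)).
    rewrite -[LHS]mulr1 def1 mulr_sumr; apply: eq_bigr => i _.
    by rewrite mulrCA [y * _]mulrC ve mulrC.
  rewrite (linear_on_sum _ c_sub gL) //.
  elim/big_rec2: _ => [|i q x _ <-]; first by apply/pi0; exists 0; rewrite mulr0.
  by rewrite piL pi_a.
exists t; first by move=> y /tP[s [ts _]]; exists s.
have four_neq0 : 4%:R != 0 :> {fraction A} by rewrite (natrM _ 2 2) mulf_neq0.
pose z := (D - t ^+ 2) / 4%:R.
have z4 : 4%:R * z = D - t ^+ 2 by rewrite mulrC divfK.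
exists z; last by rewrite z4.
have cw xi : (forall i, O (xi i)) -> c (w xi) by case: w_ext => cw _ _; apply: cw.
have z_sqr xi : (forall i, O (xi i)) -> exists e : A, z * w xi ^+ 2 = e%:F.
  move=> Oxi; have [s [ts pi_s]] := tP _ (cw xi Oxi).
  have [b def_b] : exists b : A, P xi - s = 2%:R * b.
    by apply/pi0; rewrite addrC -mulN1r piL pi_s scaleN1r gw ?addNr.
  have [d] := P_disc xi Oxi; rewrite w_disc // => disc_xi.
  (* From $P = s + 2b$ and $D w^2 = P^2 - 4d$ one gets $(D - t^2) w^2 = 4(sb + b^2 - d)$, where $s =
     t w$. *)
  exists (s * b + b ^+ 2 - d).
  have := ts; have := disc_xi; rewrite -(subrK s (P xi)) def_b.
  rewrite !(rmorphD, rmorphB, rmorphM, rmorphXn, rmorph_nat) /= => Dw tw.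
  apply: (mulfI four_neq0).
  have -> : 4%:R * (z * w xi ^+ 2) = D * w xi * w xi - (t * w xi) ^+ 2.
    by rewrite mulrA z4; ring.
  by rewrite Dw tw; ring.
have z_mul xi eta : (forall i, O (xi i)) -> (forall i, O (eta i)) ->
    exists e : A, z * w xi * w eta = e%:F.
  move=> /z_sqr[e def_e] /z_sqr[e' def_e'].
  (* The square of $z w w'$ is the product of $z w^2$ and $z w'^2$, both in [A]. *)
  apply: (@square_integral _ _ (e * e')) => //.
  by rewrite tofracM -def_e -def_e'; ring.
have sub_int x :
    submodule ([set y | exists e : A, x * y = e%:F] : set (restr {fraction A}^o)).
  split=> [|y y' [e ye] [e' ye']|d y [e ye]].
  - by exists 0; rewrite mulr0 rmorph0.
  - by exists (e + e'); rewrite mulrDr ye ye' tofracD.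
  - by exists (d * e); rewrite tofracM -ye mulrCA.
(* The values of [w] span [c], so each factor in turn may be replaced by an arbitrary element of
   [c]. *)
have z_cw y xi : c y -> (forall i, O (xi i)) -> exists e : A, z * w xi * y = e%:F.
  move=> cy Oxi; apply: (exterior_power_span w_ext (sub_int _)) cy => eta.
  exact: z_mul.
have z_c y y' : c y -> c y' -> exists e : A, z * y * y' = e%:F.
  move=> cy; apply: (exterior_power_span w_ext (sub_int _)) => xi Oxi.
  by have [e ze] := z_cw y xi cy Oxi; exists e; rewrite mulrAC.
(* Since $z c c$ lies in [A], each $z u_i$ is in $c^{-1}$, and $z = \sum_i (z u_i) v_i$. *)
exists m, (fun i => z * u i), v; split=> // [i y cy|]; first exact: z_c.
by rewrite -[LHS]mulr1 def1 mulr_sumr; apply: eq_bigr => i _; rewrite mulrA.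
Qed.
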